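(* Let $n>3$ be an integer, and let $c,d\in\mathbb{Z}$. Suppose either that $n$ is composite, or that $n$ is prime and the Legendre symbol $\left(\frac{d}{n}\right)$ is $-1$. Then \[ \det\big[(i^2+cij+dj^2)^{n-2}\big]_{0\leq i,j\leq n-1}\equiv 0\pmod{n^2}. \]
   Context: The determinant is that of the $n\times n$ integer matrix whose rows and columns are indexed by $i,j\in\{0,1,\ldots,n-1\}$ and whose $(i,j)$ entry is the integer $(i^2+cij+dj^2)^{n-2}$. *)

(* Defs.v *)
From mathcomp Require Import all_boot all_order all_algebra.

Set Implicit Arguments.
Unset Strict Implicit.
Unset Printing Implicit Defensive.

Import GRing.Theory Num.Theory.
Local Open Scope ring_scope.

(* Only meaningful when p is an odd prime. *)
Definition legendre (a : int) (p : nat) : int :=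
  if (p%:Z %| a)%Z then 0
  else if [exists x : 'I_p, ((x%:Z ^+ 2)%R == a %[mod p%:Z])%Z] then 1
  else -1.

Definition quad_form_matrix (c d : int) (n : nat) : 'M[int]_n :=
  \matrix_(i < n, j < n)
    (i%:Z ^+ 2 + c * i%:Z * j%:Z + d * j%:Z ^+ 2) ^+ (n - 2).

(* Main.v *)
Require Import Defs.
From mathcomp Require Import all_boot all_order all_algebra.
From mathcomp Require Import all_fingroup all_solvable all_field.
From mathcomp Require Import zify ring.

Set Implicit Arguments.
Unset Strict Implicit.
Unset Printing Implicit Defensive.

Import GRing.Theory.

Local Open Scope ring_scope.

(** Write [N = n - 2] and [(X^2 + c X + d)^N = \sum_k a_k X^k]; then the matrix
    has entries [\sum_k a_k i^k j^(2N-k)].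

    Composite [n].  A polynomial in [i] and [j] becomes, when [i^k] is expanded
    in the falling factorials [i^_m] with [m < n] (the others vanish at
    [i < n]), and likewise [j^l], a matrix [L G L^T] with [L = (i^_m)] lower
    triangular.  Hence the determinant of any integer polynomial matrix of
    order [n] is divisible by [(\prod_(m < n) m`!)^2] ([dvdz_det_poly]), and a
    composite [n > 3] divides [(n-2)! (n-1)!].

    Prime [n = p].  It suffices that the matrix has rank at most [p - 2] modulo
    [p] ([dvdz_det_low_rank]).  Put [q = p - 1], so that [2N = 2q - 2].  By
    Fermat, the exponents [k] and [k + q] of [i] give the same function modulo
    [p], except for [k = 0], where it is the exponents of [j] that agree.
    Grouping them writes the matrix as a sum of [q] matrices of rank one, which
    saves one dimension.  The second one comes from the quadratic character of
    [d]: substituting [d/X] for [X] gives [a_k d^k = d^N a_(2N-k)]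
    ([coef_quad_pow_sym]), so that for the middle exponent [k = (p-3)/2], whose
    partner [k + q] is also its mirror image [2N - k], one has
    [a_k = d^((p-1)/2) a_(k+q) = - a_(k+q)] by Euler's criterion, and this
    rank-one term vanishes modulo [p]. *)

(** * Determinants of matrices of small rank modulo an integer *)

(** For [M = X Y + p Z], the block matrix [B] below has determinant
    [p^r \det M] by a Schur complement, while pulling [p] out of its last [n]
    rows shows that it is divisible by [p^n]. *)
Lemma dvdz_det_low_rank (n r : nat) (p : int) (M : 'M[int]_n)
    (X : 'M[int]_(n, r)) (Y : 'M[int]_(r, n)) :
  p != 0 -> (r <= n)%N ->
  (forall i j, (p %| M i j - (X *m Y) i j)%Z) -> (p ^+ (n - r) %| \det M)%Z.
Proof.
move=> p0 le_rn dvdM.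
pose Z := \matrix_(i, j) ((M i j - (X *m Y) i j) %/ p)%Z.
have MXY : M = X *m Y + p *: Z.
  apply/matrixP=> i j; rewrite mxE [(p *: Z) i j]mxE [Z i j]mxE.
  by rewrite mulrC divzK ?dvdM // addrC subrK.
pose B := block_mx p%:M Y (- p *: X) (p *: Z).
pose B' := block_mx 1%:M Y (- X) (p *: Z).
have detB' : \det B' = \det M.
  have -> : B' = block_mx 1%:M 0 (- X) 1%:M *m block_mx 1%:M Y 0 M.
    rewrite mulmx_block !mul1mx !mulmx1 !mul0mx ?mulmx0 !addr0 MXY mulNmx.
    by rewrite addrA addNr add0r.
  by rewrite det_mulmx det_lblock det_ublock !det1 !mul1r.
have detBM : \det B = p ^+ r * \det M.
  have -> : B = B' *m block_mx p%:M 0 0 1%:M.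
    rewrite mulmx_block !mul1mx !mulmx1 !mulmx0 !addr0 !add0r.
    by rewrite /B mulNmx mul_mx_scalar scaleNr.
  by rewrite det_mulmx det_ublock detB' det_scalar det1 mulr1 mulrC.
have detBp : \det B = p ^+ n * \det (block_mx p%:M Y (- X) Z).
  have -> : B = block_mx 1%:M 0 0 p%:M *m block_mx p%:M Y (- X) Z.
    rewrite mulmx_block !mul1mx !mul0mx !addr0 !add0r.
    by rewrite /B !mul_scalar_mx scalerN scaleNr.
  by rewrite det_mulmx det_ublock det1 mul1r det_scalar.
have : p ^+ r * \det M = p ^+ r * (p ^+ (n - r) *
    \det (block_mx p%:M Y (- X) Z)).
  by rewrite -detBM detBp mulrA -exprD subnKC.
move/(mulfI (expf_neq0 _ p0)) => ->.
exact: dvdz_mulr.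
Qed.

(** * Determinants of integer polynomial matrices *)

Lemma mulz_ffact (i m : nat) :
  (i ^_ m)%:Z * i%:Z = (i ^_ m.+1)%:Z + (i ^_ m)%:Z * m%:Z.
Proof.
have [lt_im | le_mi] := ltnP i m.
  by rewrite ffactnSr ffact_small // mul0n !mul0r.
by rewrite -!PoszM -PoszD ffactnSr -mulnDr subnK.
Qed.

(** The falling factorials [i^_m] form an integral basis of the polynomials, and
    those with [m >= n] vanish at all [i < n], so [n] of them suffice. *)
Lemma poly_ffact (n : nat) (p : {poly int}) :
  exists s : nat -> int, forall i : 'I_n,
    p.[i%:Z] = \sum_(m < n) (i ^_ m)%:Z * s m.
Proof.
elim/poly_ind: p => [|p a [s sP]].
  by exists (fun=> 0) => i; rewrite horner0 big1 // => m _; rewrite mulr0.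
exists (fun m => (if m is m'.+1 then s m' else a) + m%:Z * s m) => i.
rewrite hornerMXaddC {}sP.
case: n i => [[]//|n] i.
under [RHS]eq_bigr do rewrite mulrDr mulrA.
rewrite big_split /= [X in _ = X + _]big_ord_recl ffactn0 mul1r -addrA [LHS]addrC.
congr (_ + _).
have -> : \sum_(m < n) (i ^_ (bump 0 m))%:Z * s m =
    \sum_(m < n.+1) (i ^_ m.+1)%:Z * s m.
  by rewrite big_ord_recr /= [i ^_ n.+1]ffact_small // mul0r addr0.
rewrite -big_split big_distrl; apply: eq_bigr => m _ /=.
by rewrite mulrAC mulz_ffact mulrDl.
Qed.

Lemma mulmx_ffact (n N : nat) (q : 'I_N -> {poly int}) :
  exists S : 'M[int]_(n, N),
    \matrix_(i < n, k < N) (q k).[i%:Z]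
    = \matrix_(i < n, m < n) (i ^_ m)%:Z *m S.
Proof.
have /fin_all_exists[s sP] k := poly_ffact n (q k).
exists (\matrix_(m, k) s k m); apply/matrixP=> i k.
by rewrite !mxE sP; apply: eq_bigr => m _; rewrite !mxE.
Qed.

Lemma det_ffact (n : nat) :
  \det (\matrix_(i < n, m < n) (i ^_ m)%:Z) = (\prod_(m < n) m`!)%:Z.
Proof.
rewrite det_trig; last first.
  by apply/is_trig_mxP => i m lt_im; rewrite mxE ffact_small.
rewrite (big_morph Posz PoszM (erefl 1%:Z)).
by apply: eq_bigr => m _; rewrite mxE ffactnn.
Qed.

(** The matrix factors as [L S T^T L^T], where [L] is the matrix of falling
    factorials. *)
Lemma dvdz_det_poly (n N : nat) (q r : 'I_N -> {poly int}) :
  ((\prod_(m < n) m`!)%:Z ^+ 2 %|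
   \det (\matrix_(i < n, j < n) \sum_k (q k).[i%:Z] * (r k).[j%:Z]))%Z.
Proof.
have [S SP] := mulmx_ffact n q; have [T TP] := mulmx_ffact n r.
have -> : \matrix_(i < n, j < n) (\sum_k (q k).[i%:Z] * (r k).[j%:Z])
    = \matrix_(i < n, k < N) (q k).[i%:Z]
      *m (\matrix_(i < n, k < N) (r k).[i%:Z])^T.
  apply/matrixP=> i j; rewrite !mxE.
  by apply: eq_bigr => k _; rewrite !mxE.
rewrite SP TP trmx_mul -mulmxA (mulmxA S) 2!det_mulmx det_tr det_ffact.
by rewrite mulrCA -expr2 dvdz_mull.
Qed.

(** If [n = b a] with [1 < a, b < n], then [b <= n - 2] and [a <= n - 1], so [n]
    divides the product of the last two factorials. *)
Lemma dvdn_prod_fact (n : nat) :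
  (3 < n)%N -> ~~ prime n -> (n %| \prod_(m < n) m`!)%N.
Proof.
move=> n3 /primePn [|[a /andP[a1 an] /dvdnP[b nab]]]; first by lia.
have b1 : (1 < b)%N by nia.
case: n n3 an nab => [|[|n]] // n3 an nab.
rewrite !big_ord_recr /= -mulnA dvdn_mull // nab dvdn_mul // dvdn_fact //.
  by nia.
by nia.
Qed.

(** * Coefficients of the powers of a quadratic polynomial *)

(** This is [y^D A(x/y)] without division; evaluating it in an arbitrary ring,
    {poly int} included, is what makes [coef_quad_pow_sym] a comparison of two
    evaluations. *)
Definition homog (R : comNzRingType) (D : nat) (A : {poly int}) (x y : R) : R :=
  \sum_(k < D.+1) (A`_k)%:~R * x ^+ k * y ^+ (D - k).

Lemma homogD (R : comNzRingType) (x y : R) (D : nat) (A B : {poly int}) :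
  homog D (A + B) x y = homog D A x y + homog D B x y.
Proof.
rewrite -big_split; apply: eq_bigr => k _.
by rewrite coefD rmorphD !mulrDl.
Qed.

Lemma homogZ (R : comNzRingType) (x y : R) (D : nat) (a : int) (A : {poly int}) :
  homog D (a *: A) x y = a%:~R * homog D A x y.
Proof.
rewrite big_distrr; apply: eq_bigr => k _.
by rewrite /= coefZ rmorphM /= !mulrA.
Qed.

Lemma homogMX (R : comNzRingType) (x y : R) (D : nat) (A : {poly int}) :
  homog D.+1 (A * 'X) x y = x * homog D A x y.
Proof.
rewrite /homog big_ord_recl coefMX /= mul0r mul0r add0r big_distrr.
apply: eq_bigr => k _ /=.
by rewrite coefMX /= /bump /= add1n exprS subSS mulrCA !mulrA.
Qed.

Lemma homogS (R : comNzRingType) (x y : R) (D : nat) (A : {poly int}) :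
  (size A <= D.+1)%N -> homog D.+1 A x y = y * homog D A x y.
Proof.
move=> szA; rewrite /homog big_ord_recr /= nth_default // mul0r mul0r addr0.
rewrite big_distrr; apply: eq_bigr => k _ /=.
by rewrite subSn ?exprS 1?mulrCA // -ltnS.
Qed.

Definition quad_pow (c d : int) (N : nat) : {poly int} :=
  ('X^2 + c *: 'X + d%:P) ^+ N.

Lemma size_quad_pow c d N : (size (quad_pow c d N) <= N.*2.+1)%N.
Proof.
have szQ : (size ('X^2 + c *: 'X + d%:P)%R <= 3)%N.
  apply: leq_trans (size_polyD _ _) _; rewrite geq_max.
  apply/andP; split; last by apply: leq_trans (size_polyC_leq1 _) _.
  apply: leq_trans (size_polyD _ _) _; rewrite geq_max size_polyXn /=.
  by apply: leq_trans (size_scale_leq _ _) _; rewrite size_polyX.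
elim: N => [|N IH]; first by rewrite /quad_pow expr0 size_poly1.
rewrite /quad_pow exprS; apply: leq_trans (size_polyMleq _ _) _.
rewrite -subn1 leq_subLR; apply: leq_trans (leq_add szQ IH) _; lia.
Qed.

Lemma homog_quad_pow (R : comNzRingType) (c d : int) (x y : R) N :
  homog N.*2 (quad_pow c d N) x y =
  (x ^+ 2 + c%:~R * x * y + d%:~R * y ^+ 2) ^+ N.
Proof.
elim: N => [|N IH].
  by rewrite /homog big_ord1 /quad_pow !expr0 coefC /= !mulr1.
have sz := size_quad_pow c d N.
have -> : quad_pow c d N.+1 = quad_pow c d N * 'X * 'X
    + c *: (quad_pow c d N * 'X) + d *: quad_pow c d N.
  rewrite /quad_pow exprSr !mulrDr -mulrA -expr2 scalerAr.
  by rewrite [_ * d%:P]mulrC mul_polyC.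
rewrite doubleS !homogD !homogZ !homogMX.
rewrite (homogS _ _ (leqW sz)) (homogS _ _ sz) exprSr -IH.
ring.
Qed.

(** The quadratic form takes proportional values, with ratio [d], at [(dX, 1)]
    and [(1, X)]; compare the coefficients of [X^k] in its [N]-th power at these
    two points, where the ratio becomes [d^N]. *)
Lemma coef_quad_pow_sym (c d : int) (N k : nat) : (k <= N.*2)%N ->
  (quad_pow c d N)`_k * d ^+ k = d ^+ N * (quad_pow c d N)`_(N.*2 - k).
Proof.
move=> le_k.
have := homog_quad_pow c d (d *: 'X : {poly int}) 1 N.
have := homog_quad_pow c d (1 : {poly int}) 'X N.
have Xd : ((d *: 'X) ^+ 2 + c%:~R * (d *: 'X) * 1 + d%:~R * 1 ^+ 2
   : {poly int}) = d *: (1 ^+ 2 + c%:~R * 1 * 'X + d%:~R * 'X^2).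
  rewrite -!mul_polyC.
  have -> : d%:~R = d%:P :> {poly int} by rewrite -[in RHS](intz d) rmorph_int.
  ring.
rewrite {}Xd exprZn => <-.
have -> : homog N.*2 (quad_pow c d N) (d *: 'X : {poly int}) 1 =
    \poly_(i < N.*2.+1) ((quad_pow c d N)`_i * d ^+ i).
  rewrite poly_def; apply: eq_bigr => i _.
  by rewrite expr1n mulr1 exprZn -scalerAr mulrzl -scaler_int intz scalerA mulrC.
have -> : homog N.*2 (quad_pow c d N) (1 : {poly int}) 'X =
    \poly_(i < N.*2.+1) (quad_pow c d N)`_(N.*2 - i).
  rewrite poly_def /homog (reindex_inj rev_ord_inj); apply: eq_bigr => i _ /=.
  rewrite subSS subKn; last by rewrite -ltnS.
  by rewrite expr1n mulr1 mulrzl -scaler_int intz.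
move/(congr1 (fun A : {poly int} => A`_k)).
by rewrite coefZ !coef_poly ltnS le_k.
Qed.

(** For [d^m = -1] and [N = 2m - 1], the coefficients at distance [m] on both
    sides of the middle one are opposite. *)
Lemma coef_quad_pow_opp (R : idomainType) (c d : int) (m N : nat) :
  (0 < m)%N -> N = (m + m.-1)%N -> (d%:~R : R) ^+ m = -1 ->
  ((quad_pow c d N)`_(m.-1))%:~R
  = - ((quad_pow c d N)`_(m.-1 + m.*2))%:~R :> R.
Proof.
move=> m_gt0 NE dm.
have le1 : (m.-1 <= N.*2)%N by lia.
have := congr1 (fun z : int => z%:~R : R) (coef_quad_pow_sym c d le1).
have -> : (N.*2 - m.-1 = m.-1 + m.*2)%N by lia.
rewrite [X in d ^+ X * _]NE !rmorphM !rmorphXn /= exprD.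
rewrite dm mulN1r mulNr -mulrN [in RHS]mulrC.
apply: mulIf; rewrite expf_neq0 //.
apply/eqP => d0; move: dm; rewrite d0 expr0n eqn0Ngt m_gt0.
by move/eqP; rewrite eq_sym oppr_eq0 oner_eq0.
Qed.

(** * Quadratic nonresidues and Fermat's theorem *)

(** In the cyclic group of units, [a = g^m] with [m] odd if [a] is not a square,
    and then [a] to the power [(#|F| - 1)/2] is not [1]; its square is. *)
Lemma euler_nonresidue (F : finFieldType) (a : F) :
  odd #|F| -> (forall x, x ^+ 2 != a) -> a ^+ (#|F|./2) = -1.
Proof.
move=> oddF nsq.
have a0 : a \is a GRing.unit.
  by rewrite unitfE eq_sym; have := nsq 0; rewrite expr0n.
pose u : {unit F} := FinRing.unit F a0.
have /cyclicP[g gP] := field_unit_group_cyclic [set: {unit F}]%G.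
have og : #[g]%g = #|F|.-1 by rewrite -card_finField_unit /order -gP.
have /cycleP[m um] : u \in <[g]>%g by rewrite -gP inE.
have am : a = val g ^+ m by rewrite -FinRing.val_unitX -um.
have : (a ^+ #|F|./2) ^+ 2 == 1.
  rewrite -exprM muln2 halfK oddF subn1 am exprAC.
  by rewrite -FinRing.val_unitX -og expg_order expr1n.
rewrite sqrf_eq1 => /orP[|/eqP//].
rewrite am -exprM -FinRing.val_unitX => /eqP g1.
have /eqP : (g ^+ (m * #|F|./2) = 1)%g by apply: val_inj.
rewrite -order_dvdn og.
have -> : (#|F|.-1 = 2 * #|F|./2)%N by rewrite mul2n halfK oddF subn1.
rewrite dvdn_pmul2r ?half_gt0 ?finNzRing_gt1 //.
case/dvdnP=> k mk; have /negP[] := nsq (val g ^+ k).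
by rewrite -exprM -mk am.
Qed.

Lemma Fp_nonresidue (p : nat) (d : int) :
  prime p -> legendre d p = -1 -> forall x : 'F_p, x ^+ 2 != d%:~R.
Proof.
move=> p_pr; rewrite /legendre; case: ifP => // _; case: ifP => // + _ x.
move/negbT; rewrite negb_exists => /forallP nsq.
have xp : (x < p)%N by rewrite -[X in (_ < X)%N](Fp_cast p_pr) ltn_ord.
apply: contra (nsq (Ordinal xp)) => /eqP sq /=.
rewrite eqz_mod_dvd (dvdz_pcharf (pchar_Fp p_pr)) rmorphB rmorphXn /=.
by rewrite -pmulrn natr_Zp sq subrr.
Qed.

Lemma Fp_expr_addpred (p : nat) (x : 'F_p) (k : nat) :
  prime p -> (0 < k)%N -> x ^+ (k + p.-1) = x ^+ k.
Proof.
case: k => // k p_pr _; rewrite addSnnS prednK ?prime_gt0 // exprD.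
by have := expf_card x; rewrite card_Fp // exprSr => ->.
Qed.

(** * The matrix of powers of a quadratic form *)

Lemma quad_form_matrixE (c d : int) (n : nat) (i j : 'I_n) :
  quad_form_matrix c d n i j =
  \sum_(k < (n - 2).*2.+1)
    (quad_pow c d (n - 2))`_k * i%:Z ^+ k * j%:Z ^+ ((n - 2).*2 - k).
Proof.
rewrite mxE -{1}(intz c) -{1}(intz d) -homog_quad_pow.
by apply: eq_bigr => k _; rewrite intz.
Qed.

Lemma dvdz_det_quad_form_composite (c d : int) (n : nat) :
  (3 < n)%N -> ~~ prime n ->
  (n%:Z ^+ 2 %| \det (quad_form_matrix c d n))%Z.
Proof.
move=> n3 nprime.
apply: (@dvdz_trans ((\prod_(m < n) m`!)%:Z ^+ 2)).
  by rewrite dvdz_exp2r // dvdzE /= dvdn_prod_fact.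
have -> : quad_form_matrix c d n = \matrix_(i < n, j < n)
    \sum_(k < (n - 2).*2.+1) ((quad_pow c d (n - 2))`_k *: 'X^k).[i%:Z]
      * 'X^((n - 2).*2 - k).[j%:Z].
  apply/matrixP => i j; rewrite quad_form_matrixE mxE.
  by apply: eq_bigr => k _; rewrite hornerZ !hornerXn.
exact: dvdz_det_poly.
Qed.

(** The [k]-th and the [k + q]-th summand of the homogeneous expansion, where
    [q = n - 1].  For [k = q - 1] the exponent [q - 2 - k] is truncated to [0],
    harmlessly since the coefficient of index [2q - 1] is [0]. *)
Definition quad_term (c d : int) (n i j k : nat) : int :=
  let a := fun k => (quad_pow c d (n - 2))`_k in
  let q := n.-1 in
  a k * i%:Z ^+ k * j%:Z ^+ (q.*2 - 2 - k)
  + a (k + q)%N * i%:Z ^+ (k + q) * j%:Z ^+ (q - 2 - k).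

(** The homogeneous expansion has [2q - 1] terms; they are grouped by the residue
    modulo [q] of the exponent of [i]. *)
Lemma quad_form_matrix_fold (c d : int) (n : nat) : (1 < n)%N ->
  forall i j : 'I_n,
  quad_form_matrix c d n i j = \sum_(k < n.-1) quad_term c d n i j k.
Proof.
move=> n1 i j; rewrite quad_form_matrixE /quad_term.
pose a k := (quad_pow c d (n - 2))`_k; set q := n.-1.
have -> : ((n - 2).*2 = q.*2 - 2)%N by rewrite /q; lia.
pose f k := a k * i%:Z ^+ k * j%:Z ^+ (q.*2 - 2 - k).
rewrite -(big_mkord xpredT f) (@big_cat_nat _ _ _ q) //=; [|by rewrite /q; lia].
rewrite -{2}[q]add0n big_addn big_split /= big_mkord; congr (_ + _).
have -> : ((q.*2 - 2).+1 - q = q.-1)%N by rewrite /q; lia.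
rewrite -(big_mkord xpredT
  (fun k => a (k + q)%N * i%:Z ^+ (k + q) * j%:Z ^+ (q - 2 - k))).
have -> : \sum_(0 <= k < q) a (k + q)%N * i%:Z ^+ (k + q) * j%:Z ^+ (q - 2 - k)
   = \sum_(0 <= k < q.-1) a (k + q)%N * i%:Z ^+ (k + q) * j%:Z ^+ (q - 2 - k).
  rewrite -[X in \sum_(0 <= k < X) _ = _](@prednK q); last by rewrite /q; lia.
  rewrite big_nat_recr //=.
  rewrite [a (q.-1 + q)%N]nth_default ?mul0r ?mul0r ?addr0 //.
  by apply: leq_trans (size_quad_pow _ _ _) _; rewrite /q; lia.
apply: eq_big_nat => k /andP[_ kq]; rewrite /f.
by congr (_ * _ ^+ _); rewrite /q in kq *; lia.
Qed.

(** Modulo [p] each of the [p - 1] terms [quad_term] has rank at most one, and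
    the term of index [(p - 3)/2] vanishes. *)
Lemma dvdz_det_quad_form_prime (c d : int) (p : nat) : (3 < p)%N -> prime p ->
  legendre d p = -1 -> (p%:Z ^+ 2 %| \det (quad_form_matrix c d p))%Z.
Proof.
move=> p3 p_pr ld.
have oddp : odd p by case: (even_prime p_pr) p3 => [->|].
have pF := pchar_Fp p_pr.
have dm : (d%:~R : 'F_p) ^+ p./2 = -1.
  rewrite -[in p./2](card_Fp p_pr); apply: euler_nonresidue.
    by rewrite card_Fp.
  exact: Fp_nonresidue.
pose q := p.-1; pose m := p./2.
pose a k := (quad_pow c d (p - 2))`_k.
pose term := quad_term c d p.
have FE := quad_form_matrix_fold c d (ltnW (ltnW p3)).
have m0 : (m.-1 < q)%N by rewrite /m /q; lia.
pose k0 := Ordinal m0.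
(* The k-th term is the product of a function of i and a function of j; k0 is
   omitted, which leaves the inner dimension q - 1 = p - 2 *)
pose X : 'M[int]_(p, q.-1) := \matrix_(i, r)
  let k := lift k0 r in
  if k == 0%N :> nat then a 0%N + a q * i%:Z ^+ q else i%:Z ^+ k.
pose Y : 'M[int]_(q.-1, p) := \matrix_(r, j)
  let k := lift k0 r in
  if k == 0%N :> nat then j%:Z ^+ (q - 2)
  else a k * j%:Z ^+ (q.*2 - 2 - k) + a (k + q)%N * j%:Z ^+ (q - 2 - k).
have -> : 2%N = (p - q.-1)%N by rewrite /q; lia.
apply: (@dvdz_det_low_rank _ _ _ _ X Y).
- by rewrite eqz_nat; lia.
- by rewrite /q; lia.
move=> i j; rewrite (dvdz_pcharf pF) rmorphB subr_eq0 FE mxE !rmorph_sum /=.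
rewrite (bigD1_ord k0) //= [X in X + _](_ : _ = 0) ?add0r; last first.
  rewrite /term /quad_term rmorphD !rmorphM !rmorphXn /=.
  (* Fermat applies: i and j have positive exponents k0 and q - 2 - k0 *)
  have -> : (q.*2 - 2 - m.-1 = q - 2 - m.-1 + q)%N by rewrite /q /m; lia.
  rewrite !(Fp_expr_addpred _ p_pr); [|by rewrite /q /m; lia..].
  have qm : q = m.*2 by rewrite /q /m; lia.
  rewrite -/q qm (@coef_quad_pow_opp _ _ _ m _ _ _ dm); [|by rewrite /m; lia..].
  by rewrite !mulNr addNr.
apply/eqP; apply: eq_bigr => r _; rewrite !mxE /term /quad_term /=.
set k := bump m.-1 r.
have [->|k0'] := eqVneq k 0%N.
  rewrite !subn0 add0n expr0 mulr1 mulrDl !rmorphD !rmorphM !rmorphXn /=.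
  have -> : (q.*2 - 2 = q - 2 + q)%N by rewrite /q; lia.
  by rewrite (Fp_expr_addpred _ p_pr) //; rewrite /q; lia.
rewrite !rmorphM !rmorphD !rmorphM !rmorphXn /=.
by rewrite (Fp_expr_addpred _ p_pr) ?lt0n //; ring.
Qed.

Theorem theorem1p1 (n : nat) (c d : int) (hn : (3 < n)%N)
  (h : ~~ prime n \/ (prime n /\ legendre d n = -1)) :
  (\det (quad_form_matrix c d n) = 0 %[mod (n%:Z ^+ 2)%R])%Z.
Proof.
apply/eqP; rewrite eqz_mod_dvd subr0.
case: h => [|[]]; first exact: dvdz_det_quad_form_composite.
exact: dvdz_det_quad_form_prime.
Qed.
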